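(* Let $m_c$ be a non-trivial cycle number, that is, a positive integer not belonging to the trivial cycle $\{1,2\}$ with $F_q(m_c)=m_c$ for some non-empty binary sequence $q$ with which the Collatz sequence of $m_c$ begins. Let $s$ be the length of $q$ and $r$ the number of entries of $q$ equal to $1$. Then $$m_c\;\geq\;\frac{3^{r}-2^{r}}{2^{s}-3^{r}}.$$
   Context: Let $f(n)=F_0(n)=n/2$ for $n$ even and $f(n)=F_1(n)=(3n+1)/2$ for $n$ odd. The Collatz sequence of an integer $n$ is the binary sequence whose $j$-th digit ($j\ge1$) is $0$ if $f^{j-1}(n)$ is even and $1$ if $f^{j-1}(n)$ is odd. If $q$ is a binary sequence of length $s$ with which the Collatz sequence of $n$ begins, then $F_q(n)=f^{s}(n)$, i.e. $F_q$ is the composition of the maps $F_0,F_1$ applied in the order given by the digits of $q$ read from left to right. *)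

(* Defs.v *)
From mathcomp Require Import all_boot all_order all_algebra.

Set Implicit Arguments.
Unset Strict Implicit.
Unset Printing Implicit Defensive.

Import Order.TTheory GRing.Theory Num.Theory.
Local Open Scope ring_scope.

(* [%/] is Euclidean division on [int]: [F0 n] and [F1 n] are
   the exact values n/2 and (3n+1)/2 for n even, resp. n odd, the only cases in
   which they are applied when following a Collatz sequence. *)
Definition F0 (n : int) : int := (n %/ 2)%Z.
Definition F1 (n : int) : int := ((3 * n + 1) %/ 2)%Z.

Definition f (n : int) : int := if (2 %| n)%Z then F0 n else F1 n.

(* The j-th digit for j >= 1 ([true] is 1); the value at j = 0 is junk. *)
Definition collatz_digit (n : int) (j : nat) : bool := ~~ (2 %| iter j.-1 f n)%Z.

Definition collatz_begins_with (n : int) (q : seq bool) : Prop :=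
  forall i : nat, (i < size q)%N -> nth false q i = collatz_digit n i.+1.

(* The leftmost digit of [q] is applied first. *)
Definition F (q : seq bool) (n : int) : int :=
  foldl (fun x (b : bool) => if b then F1 x else F0 x) n q.

(* Main.v *)
Require Import Defs.
From mathcomp Require Import all_boot all_order all_algebra.
From mathcomp Require Import zify lra.

Import Order.TTheory GRing.Theory Num.Theory.
Local Open Scope ring_scope.

(** Let [s] be the length of [q] and [r] its number of ones.  If the Collatz
    sequence of [n] begins with [q], then [2 ^ s * F q n = 3 ^ r * n + c],
    where [c] is the sum of [3 ^ (r - 1 - j) * 2 ^ (p_j)] over the positions
    [p_0 < p_1 < ...] of the ones of [q], counted from 0.  As [p_j >= j], [c]
    is at least the geometric sum of the [3 ^ (r - 1 - j) * 2 ^ j], which is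
    [3 ^ r - 2 ^ r]: the constant [c] is smallest when all ones come first.
    On a cycle [F q m = m], so that [m * (2 ^ s - 3 ^ r) = c >= 3 ^ r - 2 ^ r],
    which makes [2 ^ s - 3 ^ r] nonnegative as [m > 0]; dividing by it gives the
    bound.

    The lower bound on [c] is proved without writing [c] out: the inequality
    [3 ^ r * (n + 1) <= 2 ^ s * F q n + 2 ^ r] passes through one Collatz step,
    exactly at an odd step and with [3 ^ r - 2 ^ r] to spare at an even one
    ([collatz_affine_lower_bound]). *)

Lemma F0_double (n : int) : (2 %| n)%Z -> 2 * F0 n = n.
Proof. by rewrite /F0 => n_even; lia. Qed.

Lemma F1_double (n : int) : ~~ (2 %| n)%Z -> 2 * F1 n = 3 * n + 1.
Proof. by rewrite /F1 => n_odd; lia. Qed.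

Lemma collatz_begins_with_cons (n : int) (b : bool) (q : seq bool) :
  collatz_begins_with n (b :: q) ->
  b = ~~ (2 %| n)%Z /\ collatz_begins_with (f n) q.
Proof.
move=> beg; split; first exact: (beg 0%N).
move=> i lt_iq; have /= -> := beg i.+1 lt_iq.
by rewrite /collatz_digit -iterSr.
Qed.

Lemma exp2_le_exp3 (R : numDomainType) (r : nat) : 2 ^+ r <= 3 ^+ r :> R.
Proof. by rewrite lerXn2r ?nnegrE ?ler_nat. Qed.

(** The shift by 1 makes the induction close: an odd step multiplies [n + 1]
    by exactly [3 / 2], since [2 * (F1 n + 1) = 3 * (n + 1)].  At an even step
    [2 * (F0 n + 1) = (n + 1) + 1], and the extra 1 contributes the [3 ^ r] that
    pays for doubling the term [2 ^ r]. *)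
Lemma collatz_affine_lower_bound (q : seq bool) (n : int) :
  collatz_begins_with n q ->
  3 ^+ count_mem true q * (n + 1)
    <= 2 ^+ size q * F q n + 2 ^+ count_mem true q.
Proof.
elim: q n => [|b q IHq] n; first by rewrite !expr0 !mul1r.
case/collatz_begins_with_cons=> b_digit /IHq {IHq}.
have := exp2_le_exp3 int (count_mem true q).
have F_cons c : F (c :: q) n = F q (if c then F1 n else F0 n) by [].
rewrite /f b_digit F_cons; case: ifPn => [n_even|n_odd] /=.
  have := F0_double n n_even; rewrite add0n exprS.
  move: (F0 n) (F q _) => y x.
  by move: (3 ^+ _) (2 ^+ size q) (2 ^+ _) => a c d <-; lra.
have := F1_double n n_odd; rewrite add1n !exprS.
move: (F1 n) (F q _) => y x.
by move: (3 ^+ _) (2 ^+ size q) (2 ^+ _) => a c d def_n; nra.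
Qed.

Theorem theorem3p1 (m : int) (q : seq bool) (s r : nat)
  (m_pos : 0 < m)
  (m_nontrivial : m \notin [:: 1; 2])
  (q_nonempty : q <> [::])
  (q_begins : collatz_begins_with m q)
  (q_cycle : F q m = m)
  (s_def : s = size q)
  (r_def : r = count_mem true q) :
  (3 ^+ r - 2 ^+ r) / (2 ^+ s - 3 ^+ r) <= m%:Q.
Proof.
have := collatz_affine_lower_bound _ _ q_begins.
rewrite q_cycle -s_def -r_def -(ler_int rat).
rewrite !(rmorphD, rmorphM, rmorphXn) /= => bound.
have mQ_pos : 0 < m%:Q by rewrite ltr0z.
have le23 := exp2_le_exp3 rat r.
have cycle_bound : 3 ^+ r - 2 ^+ r <= m%:Q * (2 ^+ s - 3 ^+ r) by lra.
have : 0 <= 2 ^+ s - 3 ^+ r :> rat.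
  by rewrite -(pmulr_rge0 _ mQ_pos); lra.
(* A zero denominator would make the quotient 0, by convention on inverses. *)
rewrite le_eqVlt => /predU1P[<-|denom_pos]; first by rewrite invr0 mulr0 ltW.
by rewrite ler_pdivrMr.
Qed.
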